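(* Let $\lambda:\mathbb{Z}_+\to[0,\infty)$ and $\mu_1,\mu_2>0$. Assume $\lambda$ is nonincreasing and $\lambda(n)=0$ eventually for large $n$. Then for all $\mu_1'\ge\mu_1$, $$S(\lambda,\mu_1,\mu_2)\text{ is stable}\implies S(\lambda,\mu_1',\mu_2)\text{ is stable}.$$
   Context: $\mathbb{Z}_+=\{0,1,2,\dots\}$ and $e_1,e_2$ are the unit vectors of $\mathbb{Z}_+^2$. The system $S(\lambda,\mu_1,\mu_2)$ (for a nonnegative function $\lambda$ on $\mathbb{Z}_+$ and $\mu_1,\mu_2>0$) is the set of transition rates $q(x,y)$, $x\ne y$, $x,y\in\mathbb{Z}_+^2$, given by $q(x,x+e_1)=\lambda(x_2)$; $q(x,x-e_1+e_2)=\mu_1$ if $x_1\ge1$; $q(x,x-e_2)=\mu_2$ if $x_2\ge 1$; and $q(x,y)=0$ otherwise. Set $q(x)=\sum_{y\ne x}q(x,y)<\infty$ and $q(x,x)=-q(x)$. These rates define, by the minimal construction, a unique continuous-time Markov process $X=(X_1,X_2)$ on $\mathbb{Z}_+^2\cup\{\kappa\}$, where $\kappa$ is an extra state entered at the explosion time. The system is called stable if this Markov process is ergodic, that is, irreducible and positive recurrent (on $\mathbb{Z}_+^2$). *)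

(* Defs.v *)
From HB Require Import structures.
From mathcomp Require Import all_boot all_order all_algebra.
From mathcomp Require Import all_classical all_reals all_analysis.
From mathcomp Require Import measurable_realfun.

Set Implicit Arguments.
Unset Strict Implicit.
Unset Printing Implicit Defensive.

Import Order.TTheory GRing.Theory Num.Theory.
Import numFieldNormedType.Exports.

Local Open Scope classical_set_scope.
Local Open Scope ring_scope.

(** * Continuous-time Markov chains given by transition rates

    [q x y], for [x != y], is the rate from [x] to [y]; the diagonal values
    [q x x] of the function [q] are never used. *)

Section Rates.
Variables (R : realType) (E : countType) (q : E -> E -> R).

(* [fine] is harmless as long as the sum is finite, which [conservative]
   requires. *)
Definition exit_rate (x : E) : R :=
  fine (\esum_(y in [set y | y != x]) (q x y)%:E).

Definition conservative : Prop :=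
  (forall x y, x != y -> 0 <= q x y) /\
  forall x, (\esum_(y in [set y | y != x]) (q x y)%:E < +oo)%E.

Definition jump_matrix (x y : E) : R :=
  if exit_rate x == 0 then (y == x)%:R
  else if y == x then 0 else q x y / exit_rate x.

End Rates.

Section MinimalProcess.
Context {R : realType} {E : countType} {d : measure_display}
  {Omega : measurableType d}.

Definition jump_time (S : nat -> Omega -> \bar R) (n : nat) (w : Omega)
  : \bar R := (\sum_(i < n) S i w)%E.

(* Joint law of the jump chain [Y] and of the holding times [S]: under [P x],
   [Y] is a Markov chain started at [x] with the jump matrix of [q], and given
   [Y] the holding times are independent, [S i] being exponential of parameter
   [exit_rate q (Y i)].  Holding times are extended-real valued: in an absorbing
   state the parameter is 0, that is, the holding time is [+oo] almost surely. *)
Definition jump_chain_holding_times (q : E -> E -> R)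
    (P : E -> probability Omega R)
    (Y : nat -> Omega -> E) (S : nat -> Omega -> \bar R) : Prop :=
  [/\ forall n y, measurable [set w | Y n w = y],
      forall n, measurable_fun setT (S n),
      forall n w, (0 < S n w)%E &
      forall (x : E) (n : nat) (y : nat -> E) (t : nat -> R),
        (forall i, 0 <= t i) ->
        P x [set w | forall i, (i <= n)%N ->
                       Y i w = y i /\ ((t i)%:E < S i w)%E]
        = ((y 0%N == x)%:R
           * \prod_(i < n) jump_matrix q (y i) (y i.+1)
           * \prod_(i < n.+1) expR (- (exit_rate q (y i) * t i)))%:E].

(* The minimal process with rates [q], under the laws [P x], [x] being the
   initial state.  The extra state entered at the explosion time
   [sup_n jump_time S n] is [None]. *)
Definition minimal_process (q : E -> E -> R) (P : E -> probability Omega R)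
    (X : R -> Omega -> option E) : Prop :=
  conservative q /\
  exists (Y : nat -> Omega -> E) (S : nat -> Omega -> \bar R),
  [/\ jump_chain_holding_times q P Y S,
      forall n w t, 0 <= t ->
        (jump_time S n w <= t%:E < jump_time S n.+1 w)%E ->
        X t w = Some (Y n w) &
      forall w t, 0 <= t ->
        (forall n, (jump_time S n w <= t%:E)%E) -> X t w = None].

Definition irreducible (P : E -> probability Omega R)
    (X : R -> Omega -> option E) : Prop :=
  forall x y : E,
    (0 < P x [set w | (exists2 t : R, 0 <= t & X t w = Some y)%R])%E.

(* First time at which [X] is in [x] after having been out of [x]; it is [+oo]
   when there is no such time, [ereal_inf set0] being [+oo]. *)
Definition return_time (X : R -> Omega -> option E) (x : E) (w : Omega)
  : \bar R :=
  ereal_inf [set t%:E | t in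
    [set t : R | X t w = Some x /\
                 exists2 s : R, 0 <= s < t & X s w <> Some x]].

Definition positive_recurrent (P : E -> probability Omega R)
    (X : R -> Omega -> option E) : Prop :=
  forall x : E, (\int[P x]_w return_time X x w < +oo)%E.

Definition ergodic (P : E -> probability Omega R)
    (X : R -> Omega -> option E) : Prop :=
  irreducible P X /\ positive_recurrent P X.

End MinimalProcess.

(** * The system S(lambda, mu1, mu2) *)

Definition tandem_rate {R : realType} (lambda : nat -> R) (mu1 mu2 : R)
    (x y : nat * nat) : R :=
  if y == (x.1.+1, x.2) then lambda x.2
  else if (0 < x.1)%N && (y == (x.1.-1, x.2.+1)) then mu1
  else if (0 < x.2)%N && (y == (x.1, x.2.-1)) then mu2
  else 0.

(* Main.v *)
Require Import Defs.
From HB Require Import structures.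
From mathcomp Require Import all_boot all_order all_algebra.
From mathcomp Require Import all_classical all_reals all_analysis.
From mathcomp Require Import measurable_realfun.
From mathcomp Require Import zify ring lra.

Set Implicit Arguments.
Unset Strict Implicit.
Unset Printing Implicit Defensive.

Import Order.TTheory GRing.Theory Num.Theory.
Import numFieldNormedType.Exports.

Local Open Scope classical_set_scope.
Local Open Scope ring_scope.

(** Let [d n] be the numbers defined by [d (-1) = 0] and
    [mu1 * d n = mu2 * d (n - 1) + mu1 - lambda n].  The system is stable if and
    only if [lambda 0 > 0] and some [d n] is positive, and the second condition
    is monotone in [mu1].

    The recursion says that [h x = x.1 + d 0 + ... + d (x.2 - 1)] has mean drift
    zero in all states where the first queue is not empty.  In closed form
    [d n > 0] means that the sum over [k <= n] of
    [(mu1 - lambda k) * (mu1 / mu2) ^ k] is positive.  So, if [mu1 < mu2] and [n]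
    is large, the criterion compares [mu1] with the mean arrival rate when the
    second queue has its stationary geometric law under a saturated first queue.

    Suppose that [d n > 0] for some [n]; then [d] stays positive, because
    [lambda] is nonincreasing.  Lowering the drift of [h] to some [- eps] keeps
    [d n > 0] for an [n] beyond which [lambda] vanishes.  Continuing the
    increments of [h] by a small positive constant from there on, one obtains a
    Lyapunov function with negative drift off a finite set, and the process is
    positive recurrent ([slope_gt0_ergodic]).

    Suppose that [d n <= 0] for all [n].  This forces [mu1 < mu2], and after
    truncating [d] at a negative constant [h] has bounded increments and is a
    submartingale, strictly so in the empty state.  If the return time to the
    empty state had finite mean, then optional stopping at this time would give
    [0 > 0] ([positive_recurrent_slope_gt0]).

    As for monotonicity, as long as [d <= 0] a larger [mu1] makes [d] larger
    ([slope_gt0_mono]).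

    Both halves rest on general facts about chains with finitely many transitions
    out of each state and exit rates in a compact subset of the positive reals.
    There positive recurrence is equivalent to the summability of the
    probabilities [avoid n a] that the jump chain started in [a] stays away from
    [a] during its jumps number 1 to [n] ([return_time_avoid_summable],
    [avoid_summable_return_time]).  These probabilities are values of iterates of
    a finite-sum operator, so that the drift arguments
    ([avoid_summable_of_drift], [avoid_not_summable_of_submartingale]) are
    algebra. *)

(** * Drift criteria for a Markov kernel with finitely many successors *)

Section TabooKernel.
Context {R : realType} {E : countType}.
Variables (p : E -> E -> R) (succ : E -> seq E) (a : E).
Hypothesis p_ge0 : forall x y, 0 <= p x y.
Hypothesis p_sum1 : forall x, \sum_(y <- succ x) p x y = 1.

Definition mean (f : E -> R) (x : E) : R := \sum_(y <- succ x) p x y * f y.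

Definition taboo (f : E -> R) (x : E) : R :=
  \sum_(y <- succ x | y != a) p x y * f y.

(** The probability that the chain with transition matrix [p] started in a given
    state is not in [a] at any of the times 1 to [n]. *)
Definition avoid (n : nat) : E -> R := iter n taboo (fun=> 1).

Lemma le_taboo (f g : E -> R) :
  (forall x, f x <= g x) -> forall x, taboo f x <= taboo g x.
Proof. by move=> fg x; apply: ler_sum => y _; apply: ler_wpM2l. Qed.

Lemma le_iter_taboo n (f g : E -> R) :
  (forall x, f x <= g x) -> forall x, iter n taboo f x <= iter n taboo g x.
Proof. by move=> fg; elim: n => //= n IHn x; exact: le_taboo. Qed.

Lemma tabooD (f g : E -> R) x :
  taboo (fun y => f y + g y) x = taboo f x + taboo g x.
Proof. by rewrite -big_split; apply: eq_bigr => y _; rewrite mulrDr. Qed.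

Lemma tabooZ c (f : E -> R) x : taboo (fun y => c * f y) x = c * taboo f x.
Proof. by rewrite mulr_sumr; apply: eq_bigr => y _; rewrite mulrCA. Qed.

Lemma iter_tabooZ n c (f : E -> R) x :
  iter n taboo (fun y => c * f y) x = c * iter n taboo f x.
Proof.
elim: n x => //= n IHn x; rewrite -tabooZ.
by apply: eq_bigr => y _; rewrite IHn.
Qed.

Lemma iter_tabooD n (f g : E -> R) x :
  iter n taboo (fun y => f y + g y) x = iter n taboo f x + iter n taboo g x.
Proof.
elim: n x => //= n IHn x; rewrite -tabooD.
by apply: eq_bigr => y _; rewrite IHn.
Qed.

Lemma iter_taboo_ge0 n (f : E -> R) :
  (forall x, 0 <= f x) -> forall x, 0 <= iter n taboo f x.
Proof.
move=> f0; elim: n => //= n IHn x.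
by apply: sumr_ge0 => y _; rewrite mulr_ge0.
Qed.

Lemma taboo_le_mean (f : E -> R) x :
  (forall y, 0 <= f y) -> taboo f x <= mean f x.
Proof.
move=> f0; rewrite /mean (bigID (fun y => y != a)) /= lerDl.
by apply: sumr_ge0 => y _; rewrite mulr_ge0.
Qed.

Lemma avoid_ge0 n x : 0 <= avoid n x.
Proof. by apply: iter_taboo_ge0 => _; exact: ler01. Qed.

Lemma avoid1_le x : avoid 1 x <= 1.
Proof.
apply: (@le_trans _ _ (mean (fun=> 1) x)).
  by apply: taboo_le_mean => _; exact: ler01.
by rewrite /mean; under eq_bigr do rewrite mulr1; rewrite p_sum1.
Qed.

Lemma avoidS_le n x : avoid n.+1 x <= avoid n x.
Proof.
by rewrite /avoid iterSr; apply: le_iter_taboo => y; exact: avoid1_le.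
Qed.

Lemma avoid_nonincr m n x : (m <= n)%N -> avoid n x <= avoid m x.
Proof.
move=> /subnK<-; elim: (n - m)%N => [|k IHk] //.
by rewrite addSn; exact: le_trans (avoidS_le _ _) IHk.
Qed.

Lemma avoid_le1 n x : avoid n x <= 1.
Proof. exact: (@avoid_nonincr 0). Qed.

Definition reaches x := exists n, avoid n x < 1.

(** The disjunction allows [y] to be the target itself, which need not be known
    to be reached again from [a]. *)
Lemma reaches_step x y :
  y \in succ x -> 0 < p x y -> y = a \/ reaches y -> reaches x.
Proof.
move=> yx pxy ya.
have [n yn] : exists n, y != a -> avoid n y < 1.
  by case: ya => [->|[n yn]]; [exists 0%N; rewrite eqxx|exists n].
exists n.+1; rewrite -(p_sum1 x) /avoid /= /taboo big_mkcond /=.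
rewrite (big_rem y) //= [ltRHS](big_rem y) //=.
apply: ltr_leD.
  case: eqP => [//|/eqP /yn yn1]; rewrite -[ltRHS]mulr1.
  by rewrite ltr_pM2l.
apply: ler_sum => z _; case: ifP => // _.
by rewrite -[leRHS]mulr1 ler_wpM2l // avoid_le1.
Qed.

Lemma reaches_uniform (F : seq E) : (forall x, x \in F -> reaches x) ->
  exists m r, 0 < r /\ forall x, x \in F -> avoid m x <= 1 - r.
Proof.
elim: F => [|z F IHF] FP; first by exists 0%N, 1; split.
have [|m [r [r0 mr]]] := IHF.
  by move=> x xF; apply: FP; rewrite inE xF orbT.
have [n zn] : reaches z by apply: FP; exact: mem_head.
exists (maxn m n), (Num.min r (1 - avoid n z)); split.
  by rewrite lt_min r0 subr_gt0.
move=> x; rewrite inE => /predU1P[->|/mr xr].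
  apply: le_trans (avoid_nonincr z (leq_maxr m n)) _.
  by rewrite lerBrDr -lerBrDl ge_min lexx orbT.
apply: le_trans (avoid_nonincr x (leq_maxl m n)) _.
by apply: le_trans xr _; rewrite lerB // ge_min lexx.
Qed.

(** The sum [psi] of the first [m] avoidance probabilities satisfies
    [taboo psi = psi - 1 + avoid m], so it decreases by at least [r] in mean on
    [F] if [a] is reached within [m] steps with probability at least [r] from
    there.  A multiple of [psi] thus compensates the failure on [F] of the drift
    condition on [V], and the corrected function [W] dominates [eps] times the
    expected hitting time of [a]. *)
Lemma avoid_summable_of_drift (V : E -> R) (F : seq E) (eps b : R) :
  0 < eps -> 0 <= b -> (forall x, 0 <= V x) ->
  (forall x, x \in F -> reaches x) ->
  (forall x, mean V x <= V x - eps + b * (x \in F)%:R) ->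
  forall x, exists B, forall n, \sum_(i < n) avoid i x <= B.
Proof.
move=> eps0 b0 V0 reachF drift x.
have [m [r [r0 mr]]] := reaches_uniform reachF.
pose psi y : R := \sum_(j < m) avoid j y.
have psi0 y : 0 <= psi y by apply: sumr_ge0 => j _; exact: avoid_ge0.
have tpsi y : taboo psi y = psi y - 1 + avoid m y.
  have -> : taboo psi y = \sum_(j < m) avoid j.+1 y.
    rewrite /taboo /psi exchange_big /=; apply: eq_bigr => y' _.
    by rewrite mulr_sumr.
  have : \sum_(i < m.+1) avoid i y = psi y + avoid m y by rewrite big_ord_recr.
  by rewrite big_ord_recl /= addrAC => <-; rewrite addrAC subrr add0r.
pose W y := V y + (b / r) * psi y.
have br0 : 0 <= b / r by rewrite divr_ge0 // ltW.
have W0 y : 0 <= W y by rewrite addr_ge0 // mulr_ge0.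
have tW y : taboo W y <= W y - eps.
  rewrite /W tabooD tabooZ tpsi.
  have tV := le_trans (taboo_le_mean y V0) (drift y).
  have : b / r * (1 - avoid m y) >= b * (y \in F)%:R.
    have [yF|_] := boolP (y \in F); last first.
      by rewrite mulr0 mulr_ge0 // subr_ge0 avoid_le1.
    rewrite mulr1 -[leLHS]mulr1 -mulrA ler_wpM2l // ler_pdivlMl // mulr1.
    by rewrite lerBrDl -lerBrDr mr.
  lra.
have iW n y : eps * \sum_(i < n) avoid i y + iter n taboo W y <= W y.
  elim: n => [|n IHn]; first by rewrite big_ord0 mulr0 add0r.
  apply: le_trans IHn; rewrite big_ord_recr /= mulrDr -addrA lerD2l.
  rewrite -iter_tabooZ -[taboo _ y]/(iter n.+1 taboo W y) iterSr -iter_tabooD.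
  by apply: le_iter_taboo => z; rewrite mulr1 addrC -lerBrDr tW.
exists (W x / eps) => n; rewrite ler_pdivlMr // mulrC.
by apply: le_trans (iW n x); rewrite lerDl iter_taboo_ge0.
Qed.

(** As [h a = 0], killing the chain in [a] keeps [h] a submartingale.  So the
    expectation of [h] before the return to [a] stays above [eta = mean h a],
    whereas it is at most [B * n * avoid n a] after [n] steps.  Hence [avoid n a]
    is at least [eta / (B * n)], and the harmonic series diverges. *)
Lemma avoid_not_summable_of_submartingale (h : E -> R) (B : R) :
  h a = 0 -> (forall x, h x <= mean h x) -> 0 < mean h a ->
  (forall x y, y \in succ x -> h y <= h x + B) ->
  ~ exists C, forall n, \sum_(i < n) avoid i a <= C.
Proof.
move=> ha0 sub_h drift_a incr [C avoidC].
have tabE x : taboo h x = mean h x.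
  rewrite /mean (bigID (fun y => y != a)) /= [X in _ = _ + X]big1 ?addr0 //.
  by move=> y /negPn/eqP ->; rewrite ha0 mulr0.
have iter_ge n : taboo h a <= iter n.+1 taboo h a.
  elim: n => [|n IHn] //; apply: le_trans IHn _.
  by rewrite [in leRHS]iterSr; apply: le_iter_taboo => y; rewrite tabE.
have iter_le n x : iter n taboo h x <= (h x + B *+ n) * avoid n x.
  elim: n x => [|n IHn] x; first by rewrite /= mulr0n addr0 mulr1.
  rewrite -[avoid n.+1 x]/(taboo (avoid n) x) -tabooZ /= /taboo.
  rewrite big_seq_cond [leRHS]big_seq_cond.
  apply: ler_sum => y /andP[yx _]; apply: ler_wpM2l => //.
  apply: le_trans (IHn y) _; apply: ler_wpM2r; first exact: avoid_ge0.
  by rewrite mulrS addrA lerD2r incr.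
set eta := mean h a in drift_a.
have le_avoid n : eta <= (B *+ n.+1) * avoid n.+1 a.
  by have := le_trans (iter_ge n) (iter_le n.+1 a); rewrite ha0 add0r tabE.
have B0 : 0 < B.
  have := lt_le_trans drift_a (le_avoid 0%N).
  rewrite mulr1n => BA; rewrite ltNge; apply/negP => B0.
  by move: BA; rewrite ltNge mulr_le0_ge0 // avoid_ge0.
have harm_le n : series (@harmonic R) n <= B / eta * C.
  rewrite -ler_pdivrMl ?divr_gt0 // invf_div.
  have := avoidC n.+1; rewrite big_ord_recl; apply: le_trans.
  rewrite -[leLHS]add0r; apply: lerD; first exact: avoid_ge0.
  rewrite /series /= big_mkord mulr_sumr; apply: ler_sum => i _.
  rewrite ler_pdivrMr ?ltr0n // ler_pdivrMr //.
  by rewrite -mulrA mulr_natl [leRHS]mulrC; exact: le_avoid.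
apply: (@dvg_harmonic R); apply: nondecreasing_is_cvgn.
  apply/nondecreasing_seqP => n; rewrite seriesSr lerDl.
  by rewrite invr_ge0 ler0n.
by exists (B / eta * C) => _ [n _ <-].
Qed.

End TabooKernel.

(** * Jump chain of a locally finite system of rates *)

Section LocallyFiniteRates.
Context {R : realType} {E : countType}.
Variables (q : E -> E -> R) (succ : E -> seq E).

Definition locally_finite_rates : Prop :=
  [/\ forall x y, x != y -> 0 <= q x y,
      forall x, uniq (succ x),
      forall x, x \notin succ x &
      forall x y, y != x -> y \notin succ x -> q x y = 0].

Hypothesis lfq : locally_finite_rates.

Lemma exit_rate_sum x : exit_rate q x = \sum_(y <- succ x) q x y.
Proof.
have [q0 us ns q_out] := lfq.
have neq y : y \in succ x -> x != y by apply: contraTneq => <-.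
rewrite /exit_rate (esumID [set` succ x]); last first.
  by move=> y /= yx; rewrite lee_fin q0 // eq_sym.
rewrite [X in (_ + X)%E]esum1 ?adde0; last first.
  by move=> y [/= yx /negP ysx]; rewrite q_out.
have -> : [set y | y != x] `&` [set` succ x] = [set` succ x].
  by apply/seteqP; split=> [y []//|y /= yx]; split => //=; rewrite eq_sym neq.
rewrite esum_fset; first by rewrite -fsbig_seq // sumEFin.
  exact: finite_seq.
by move=> y; rewrite inE /= => yx; rewrite lee_fin q0 // neq.
Qed.

Hypothesis exit_gt0 : forall x, 0 < exit_rate q x.

Lemma jump_matrixE x y :
  jump_matrix q x y = if y == x then 0 else q x y / exit_rate q x.
Proof. by rewrite /jump_matrix gt_eqF. Qed.

Lemma jump_matrix_ge0 x y : 0 <= jump_matrix q x y.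
Proof.
have [q0 _ _ _] := lfq.
rewrite jump_matrixE; case: eqVneq => // yx.
by rewrite divr_ge0 ?q0 1?eq_sym // ltW.
Qed.

Lemma jump_matrix_succ x y :
  y \in succ x -> jump_matrix q x y = q x y / exit_rate q x.
Proof.
have [_ _ ns _] := lfq.
by move=> yx; rewrite jump_matrixE ifN //; apply: contraTneq yx => ->.
Qed.

Lemma jump_matrix_sum1 x : \sum_(y <- succ x) jump_matrix q x y = 1.
Proof.
rewrite big_seq (eq_bigr (fun y => q x y / exit_rate q x)); last first.
  by move=> y; exact: jump_matrix_succ.
by rewrite -big_seq -mulr_suml -exit_rate_sum divff // gt_eqF.
Qed.

End LocallyFiniteRates.

Section JumpChainLaw.
Context {R : realType} {E : countType} {d : measure_display}
  {Omega : measurableType d}.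
Variables (q : E -> E -> R) (succ : E -> seq E).
Hypothesis lfq : locally_finite_rates q succ.
Hypothesis exit_gt0 : forall x, 0 < exit_rate q x.
Variables (P : E -> probability Omega R).
Variables (Y : nat -> Omega -> E) (S : nat -> Omega -> \bar R).
Hypothesis law : jump_chain_holding_times q P Y S.

Local Notation J := (jump_matrix q).

Let mY n y : measurable [set w | Y n w = y].
Proof. by case: law. Qed.

Let mS n : measurable_fun setT (S n).
Proof. by case: law. Qed.

Let S_gt0 n w : (0 < S n w)%E.
Proof. by case: law. Qed.

Lemma measurable_holding_gt n (t : \bar R) : measurable [set w | (t < S n w)%E].
Proof.
by rewrite -[X in measurable X]setTI; exact: emeasurable_fun_o_infty.
Qed.

Definition follows n (y : nat -> E) : set Omega :=
  [set w | forall i, (i <= n)%N -> Y i w = y i].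

Definition follows_prob x n (y : nat -> E) : R :=
  (y 0%N == x)%:R * \prod_(i < n) J (y i) (y i.+1).

Lemma measurable_forall (Q : nat -> Prop) (A : nat -> set Omega) :
  (forall i, Q i -> measurable (A i)) ->
  measurable [set w | forall i, Q i -> A i w].
Proof.
move=> mA; rewrite [X in measurable X](_ : _ = \bigcap_(i in Q) A i) //.
exact: bigcap_measurableType.
Qed.

Lemma measurable_follows n y : measurable (follows n y).
Proof.
apply: (@measurable_forall (fun i => (i <= n)%N)
  (fun i => [set w | Y i w = y i])).
by move=> i _.
Qed.

Lemma follows_law_last x n y t : 0 <= t ->
  P x (follows n y `&` [set w | (t%:E < S n w)%E])
  = (follows_prob x n y * expR (- (exit_rate q (y n) * t)))%:E.
Proof.
case: law => _ _ _ lawE t0.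
pose tt i := if i == n then t else 0.
rewrite [X in P x X](_ : _ = [set w | forall i, (i <= n)%N ->
    Y i w = y i /\ ((tt i)%:E < S i w)%E]); last first.
  apply/seteqP; split=> w /=.
    move=> [yw tw] i i_n; split; first exact: yw.
    by rewrite /tt; case: eqP => [->//|_].
  move=> yw; split=> [i /yw[]//|].
  by have [_] := yw n (leqnn n); rewrite /tt eqxx.
rewrite lawE; last by move=> i; rewrite /tt; case: ifP.
rewrite big_ord_recr /= {2}/tt eqxx [X in _ * (X * _)]big1 ?mul1r //.
by move=> i _; rewrite /tt ltn_eqF // mulr0 oppr0 expR0.
Qed.

Lemma follows_law x n y : P x (follows n y) = (follows_prob x n y)%:E.
Proof.
have := @follows_law_last x n y 0 (lexx 0).
rewrite mulr0 oppr0 expR0 mulr1 => <-; congr (P x _).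
by apply/seteqP; split=> w /= => [yw|[]//]; split.
Qed.

Lemma measurable_chain_in n (s : seq E) : measurable [set w | Y n w \in s].
Proof.
rewrite (_ : [set w | _] = \bigcup_(y in [set` s]) [set w | Y n w = y]).
  by apply: fin_bigcup_measurable.
by apply/seteqP; split=> w /= => [ws|[y /= ys ->]//]; exists (Y n w).
Qed.

Lemma prob_split_seq x A n (s : seq E) : measurable A -> uniq s ->
  P x (A `&` [set w | Y n w \in s]) =
  (\sum_(z <- s) P x (A `&` [set w | Y n w = z]))%E.
Proof.
move=> mA; elim: s => [|z s IHs] /=.
  rewrite big_nil (_ : _ `&` _ = set0) ?measure0 //.
  by apply/seteqP; split => w // [].
move=> /andP[zs us]; rewrite big_cons -IHs //.
rewrite [X in P x X = _](_ : _ =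
  (A `&` [set w | Y n w = z]) `|` (A `&` [set w | Y n w \in s])).
  rewrite measureU //.
  - exact: measurableI.
  - apply: measurableI => //; exact: measurable_chain_in.
  - by apply/seteqP; split=> // w /= [[_ ->] [_ /=]]; rewrite (negPf zs).
apply/seteqP; split=> w /=; rewrite inE.
  by move=> [Aw /predU1P[]]; [left|right].
by move=> [[Aw ->]|[Aw ->]]; rewrite ?eqxx ?orbT.
Qed.

Definition extend n (y : nat -> E) z i := if (i <= n)%N then y i else z.

Lemma follows_extend n y z :
  follows n y `&` [set w | Y n.+1 w = z] = follows n.+1 (extend n y z).
Proof.
apply/seteqP; split=> w /=; rewrite /follows /extend /=.
  move=> [yw <-] i; rewrite leq_eqVlt ltnS => /predU1P[->|i_n].
    by rewrite ltnn.
  by rewrite i_n yw.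
move=> yw; split=> [i i_n|]; first by rewrite yw ?i_n // leqW.
by rewrite yw // ltnn.
Qed.

Lemma follows_prob_extend x n y z :
  follows_prob x n.+1 (extend n y z) = follows_prob x n y * J (y n) z.
Proof.
rewrite /follows_prob big_ord_recr /= /extend leq0n leqnn ltnn -mulrA.
congr (_ * (_ * _)); apply: eq_bigr => i _.
by rewrite (ltnW (ltn_ord i)) ltn_ord.
Qed.

(** Splitting over the successors loses nothing, because the jump probabilities
    to these finitely many states already add up to 1. *)
Lemma prob_split_next x n y A : measurable A -> A `<=` follows n y ->
  P x A = (\sum_(z <- succ (y n)) P x (A `&` [set w | Y n.+1 w = z]))%E.
Proof.
move=> mA Ay; have [_ us _ _] := lfq.
set U := [set w | Y n.+1 w \in succ (y n)].
have mU : measurable U by exact: measurable_chain_in.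
have mB := measurable_follows n y.
have B_out : P x (follows n y `\` U) = 0%E.
  have finB : (P x (follows n y) < +oo)%E by rewrite follows_law ltry.
  have -> : P x (follows n y `\` U) =
      (P x (follows n y) - P x (follows n y `&` U))%E.
    exact: measureD.
  rewrite prob_split_seq // follows_law.
  rewrite (eq_bigr (fun z => (follows_prob x n y * J (y n) z)%:E)); last first.
    by move=> z _; rewrite follows_extend follows_law follows_prob_extend.
  by rewrite sumEFin -mulr_sumr (jump_matrix_sum1 lfq) // mulr1 subee.
have -> : P x A = (P x (A `\` U) + P x (A `&` U))%E by exact: measureDI.
rewrite prob_split_seq //.
rewrite [X in (X + _)%E](_ : _ = 0%E) ?add0e //.
apply: (subset_measure0 _ _ _ B_out); try exact: measurableD.
by apply: setSD.
Qed.

(** The holding time of index [n + m] is in the event because it is the summand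
    of the return time that has to be estimated while [a] is avoided. *)
Definition avoid_event a n (y : nat -> E) m (t : R) : set Omega :=
  follows n y `&` [set w | forall j, (n < j <= n + m)%N -> Y j w <> a]
           `&` [set w | (t%:E < S (n + m) w)%E].

Lemma measurable_avoid_event a n y m t : measurable (avoid_event a n y m t).
Proof.
apply: measurableI; last exact: measurable_holding_gt.
apply: measurableI; first exact: measurable_follows.
apply: (@measurable_forall (fun j => (n < j <= n + m)%N)
  (fun j => [set w | Y j w <> a])) => j _.
exact: measurableC (mY j a).
Qed.

(** Conditioning on the first jump after the path [y] turns one step of avoidance
    into one application of [taboo]; the last state [z] contributes the tail of
    an exponential variable of parameter [exit_rate q z]. *)
Lemma avoid_event_law a x n y m t : 0 <= t ->
  P x (avoid_event a n y m t) =
  (follows_prob x n y *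
   iter m (taboo J succ a) (fun z => expR (- (exit_rate q z * t))) (y n))%:E.
Proof.
move=> t0; elim: m n y => [|m IHm] n y.
  rewrite -follows_law_last //; congr (P x _); rewrite /avoid_event addn0.
  rewrite [X in follows n y `&` X](_ : _ = setT) ?setIT //.
  apply/seteqP; split=> // w _ j /andP[nj jn].
  by move: (leq_trans nj jn); rewrite ltnn.
rewrite (@prob_split_next _ n y) //; last by move=> w [[]].
  pose e z := expR (- (exit_rate q z * t)).
  rewrite (eq_bigr (fun z => ((z != a)%:R * (follows_prob x n y *
     (J (y n) z * iter m (taboo J succ a) e z)))%:E)); last first.
    move=> z _; case: eqVneq => [->|za]; rewrite ?mul0r ?mul1r.
      rewrite (_ : _ `&` _ = set0) ?measure0 //.
      apply/seteqP; split=> // w [[[_ +] _] /=].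
      by move=> /(_ n.+1); rewrite ltnSn addnS ltnS leq_addr => /(_ isT).
    rewrite mulrA -follows_prob_extend.
    transitivity (P x (avoid_event a n.+1 (extend n y z) m t)); last first.
      by rewrite IHm [in LHS]/extend ltnn -/(extend n y z).
    congr (P x _).
    rewrite /avoid_event -follows_extend addnS -addSn.
    apply/seteqP; split=> w /=.
      move=> [[[yw ya] tw] Yz]; split=> //; split=> // j /andP[nj jm].
      by apply: ya; rewrite (ltnW nj).
    move=> [[[yw Yz] ya] tw]; split=> //; split=> //; split=> // j /andP[nj jm].
    have [nj1|] := ltnP n.+1 j; first by apply: ya; rewrite nj1.
    rewrite leq_eqVlt ltnS leqNgt nj orbF => /eqP ->.
    by rewrite Yz; exact/eqP.
  rewrite sumEFin /= [in RHS]/taboo mulr_sumr [in RHS]big_mkcond /=; congr EFin.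
  by apply: eq_bigr => z _; case: ifP => _; rewrite ?mul1r ?mul0r.
exact: measurable_avoid_event.
Qed.

End JumpChainLaw.

(** * Nonnegative series and integrals of extended reals *)

Section ExtendedSeries.
Context {R : realType}.
Local Open Scope ereal_scope.

Lemma nneseries_le (u : nat -> \bar R) (x : \bar R) :
  (forall i, 0 <= u i) -> (forall n, \sum_(i < n) u i <= x) ->
  \sum_(i <oo) u i <= x.
Proof.
move=> u0 ux; apply: lime_le; first exact: is_cvg_nneseries.
by apply: nearW => n; rewrite big_mkord.
Qed.

Lemma le_nneseries (u : nat -> \bar R) n :
  (forall i, 0 <= u i) -> \sum_(i < n) u i <= \sum_(i <oo) u i.
Proof.
by move=> u0; rewrite -(big_mkord xpredT u); exact: nneseries_lim_ge.
Qed.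

Lemma ereal_unbounded_pinfty (x : \bar R) :
  (forall n, n%:R%:E <= x) -> x = +oo.
Proof.
move=> nx; apply/eqyP => r _; have [n rn] : exists n, (r <= n%:R)%R.
  by exists (Num.truncn r).+1; exact/ltW/truncnS_gt.
by apply: le_trans (nx n); rewrite lee_fin.
Qed.

(** The series is [s] rounded up to an integer.  Integrating it replaces the
    layer-cake formula for the mean of a holding time. *)
Lemma le_layers (s : \bar R) :
  0 <= s -> s <= \sum_(k <oo) ((k%:R%:E < s)%E%:R)%:E.
Proof.
set u := fun k : nat => ((k%:R%:E < s)%E%:R)%:E : \bar R.
have u0 k : 0 <= u k by rewrite lee_fin ler0n.
case: s @u u0 => [r| |] // u u0 s0.
  have partial n : (r <= n%:R)%R -> r%:E <= \sum_(k < n) u k.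
    elim: n => [|n IHn]; first by rewrite big_ord0 lee_fin.
    move=> rn; have [rn'|nr] := leP r n%:R.
      by rewrite big_ord_recr /= (le_trans (IHn rn')) // leeDl.
    rewrite (eq_bigr (fun=> 1%:E)); last first.
      move=> k _; rewrite /u lte_fin (le_lt_trans _ nr) // ler_nat.
      by rewrite -ltnS.
    by rewrite sumEFin sumr_const card_ord lee_fin.
  have [n rn] : exists n, (r <= n%:R)%R.
    by exists (Num.truncn r).+1; exact/ltW/truncnS_gt.
  by apply: le_trans (partial n rn) _; exact: le_nneseries.
rewrite [leRHS]ereal_unbounded_pinfty // => n.
apply: le_trans (le_nneseries n u0).
rewrite (eq_bigr (fun=> 1%:E)) => [|k _]; last by rewrite /u ltry.
by rewrite sumEFin sumr_const card_ord lee_fin.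
Qed.

(** The integral of a nonnegative function is the supremum of the integrals of
    the simple functions below it.  So it is monotone even for functions that
    are not known to be measurable, such as a return time. *)
Lemma ge0_le_lower_integral d (T : measurableType d)
    (mu : {measure set T -> \bar R}) (f g : T -> \bar R) :
  (forall x, 0 <= f x) -> (forall x, f x <= g x) ->
  \int[mu]_x f x <= \int[mu]_x g x.
Proof.
move=> f0 fg; have g0 x : 0 <= g x by exact: le_trans (fg x).
rewrite !ge0_integralTE //; apply: le_ereal_sup => _ [h hf <-].
by exists h => // x; exact: le_trans (hf x) (fg x).
Qed.

End ExtendedSeries.

(** * Return time and jump chain *)

Section ReturnTime.
Context {R : realType} {E : countType} {d : measure_display}
  {Omega : measurableType d}.
Variables (q : E -> E -> R) (succ : E -> seq E).
Hypothesis lfq : locally_finite_rates q succ.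
Variables (c C : R).
Hypothesis c_gt0 : 0 < c.
Hypothesis exit_ge : forall x, c <= exit_rate q x.
Hypothesis exit_le : forall x, exit_rate q x <= C.
Variables (P : E -> probability Omega R) (X : R -> Omega -> option E).
Variables (Y : nat -> Omega -> E) (S : nat -> Omega -> \bar R).
Hypothesis law : jump_chain_holding_times q P Y S.
Hypothesis X_jump : forall n w t, 0 <= t ->
  (jump_time S n w <= t%:E < jump_time S n.+1 w)%E -> X t w = Some (Y n w).
Hypothesis X_explosion : forall w t, 0 <= t ->
  (forall n, (jump_time S n w <= t%:E)%E) -> X t w = None.

Local Notation J := (jump_matrix q).

Let S_gt0 n w : (0 < S n w)%E.
Proof. by case: law. Qed.

Let exit_gt0 x : 0 < exit_rate q x.
Proof. exact: lt_le_trans (exit_ge x). Qed.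

Lemma jump_timeS n w : jump_time S n.+1 w = (jump_time S n w + S n w)%E.
Proof. by rewrite /jump_time big_ord_recr. Qed.

Lemma jump_time0 w : jump_time S 0 w = 0%E.
Proof. by rewrite /jump_time big_ord0. Qed.

Lemma jump_time_homo w m n :
  (m <= n)%N -> (jump_time S m w <= jump_time S n w)%E.
Proof.
move=> /subnK <-; elim: (n - m)%N => // k IHk.
by rewrite addSn jump_timeS (le_trans IHk) // leeDl // ltW.
Qed.

Lemma jump_time_ge0 n w : (0 <= jump_time S n w)%E.
Proof. by rewrite -(jump_time0 w) jump_time_homo. Qed.

Lemma X_at_jump_time n w t : jump_time S n w = t%:E -> X t w = Some (Y n w).
Proof.
move=> nt; apply: X_jump; first by rewrite -lee_fin -nt jump_time_ge0.
by rewrite jump_timeS nt lexx /= lteDl.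
Qed.

Lemma X_eq_Some t w y : 0 <= t -> X t w = Some y ->
  exists n, (jump_time S n w <= t%:E < jump_time S n.+1 w)%E /\ Y n w = y.
Proof.
move=> t0 Xt.
have [n] : exists n, (t%:E < jump_time S n w)%E.
  apply: contrapT => /forallNP late; move: Xt; rewrite X_explosion // => n.
  by rewrite leNgt; exact/negP/late.
elim: n => [|n IHn] tn; first by move: tn; rewrite jump_time0 lte_fin ltNge t0.
have [/IHn//|nt] := ltP t%:E (jump_time S n w).
exists n; rewrite nt tn; split=> //.
by move: Xt; rewrite (@X_jump n) ?nt // => -[].
Qed.

Lemma return_time_ge0 x w : (0 <= return_time X x w)%E.
Proof.
apply: le_ereal_inf_tmp => _ [t [_ [s /andP[s0 st] _]] <-].
by rewrite lee_fin (le_trans s0) // ltW.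
Qed.

(** The chain started in [x] and killed in [a] is still alive after [i] jumps, and
    then stays in its current state for more than [t]. *)
Definition alive a x i (t : R) : set Omega := avoid_event Y S a 0 (fun=> x) i t.

Lemma aliveE a x i t w : alive a x i t w <->
  [/\ Y 0 w = x, forall j, (0 < j <= i)%N -> Y j w <> a & (t%:E < S i w)%E].
Proof.
rewrite /alive /avoid_event /follows /= add0n; split.
  by move=> [[Yx Yn] tS]; split => //; exact: Yx.
by move=> [Yx Yn tS]; split => //; split => // j; rewrite leqn0 => /eqP ->.
Qed.

Lemma measurable_alive a x i t : measurable (alive a x i t).
Proof. exact: (measurable_avoid_event law). Qed.

Lemma alive_law a x i t : 0 <= t ->
  P x (alive a x i t) =
  (iter i (taboo J succ a) (fun z => expR (- (exit_rate q z * t))) x)%:E.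
Proof.
move=> t0; rewrite (avoid_event_law lfq exit_gt0 law) //.
by rewrite /follows_prob eqxx big_ord0 !mul1r.
Qed.

Let J_ge0 x y : 0 <= J x y.
Proof. exact: jump_matrix_ge0 lfq exit_gt0 x y. Qed.

Lemma alive_ge a x i :
  ((expR (- C) * avoid J succ a i x)%:E <= P x (alive a x i 1))%E.
Proof.
rewrite alive_law // lee_fin -iter_tabooZ //; apply: le_iter_taboo => // y.
by rewrite mulr1 ler_expR lerN2 mulr1.
Qed.

Lemma alive_le a x i k :
  (P x (alive a x i k%:R) <= (expR (- c) ^+ k * avoid J succ a i x)%:E)%E.
Proof.
rewrite alive_law // lee_fin -iter_tabooZ //; apply: le_iter_taboo => // y.
rewrite mulr1 -expRM_natr mulNr ler_expR lerN2 ler_wpM2r //.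
Qed.

(** If the process is in [x] at time [t] after having left it, then the jump
    chain is in [x] after its jump number [k] for some [k >= 1] with
    [jump_time S k w <= t].  The events with index [k] or more do not hold, and
    each other one accounts for a holding time greater than 1. *)
Lemma alive_sum_le_return_time x w n :
  (\sum_(i < n) (\1_(alive x x i 1) w)%:E <= return_time X x w)%E.
Proof.
have [Y0|/eqP Y0] := eqVneq (Y 0 w) x; last first.
  rewrite big1 ?return_time_ge0 // => i _.
  by rewrite indicE memNset // aliveE => -[].
apply: le_ereal_inf_tmp => _ [t [Xt [s /andP[s0 st] Xs]] <-].
have t0 : 0 <= t by rewrite (le_trans s0) // ltW.
have [k [/andP[kt tk] Yk]] := X_eq_Some t0 Xt.
have k_gt0 : (0 < k)%N.
  rewrite lt0n; apply: contra_notN Xs => /eqP k0.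
  rewrite -Yk k0; apply: X_jump => //; rewrite jump_time0 lee_fin s0 /=.
  by rewrite -[1%N]/(0.+1) -k0 (lt_trans _ tk) // lte_fin.
apply: le_trans kt.
apply: (@le_trans _ _ (jump_time S (minn n k) w)); last first.
  by apply: jump_time_homo; exact: geq_minr.
elim: n => [|n IHn]; first by rewrite big_ord0 jump_time_ge0.
rewrite big_ord_recr /=; have [kn|nk] := leqP k n.
  rewrite (minn_idPr (leqW kn)) -[in leRHS](minn_idPr kn).
  rewrite indicE memNset ?adde0 //.
  by rewrite aliveE => -[_ /(_ k)]; rewrite k_gt0 kn => /(_ isT).
rewrite (minn_idPl nk) jump_timeS leeD //.
  by move: IHn; rewrite (minn_idPl (ltnW nk)).
rewrite indicE; case: (boolP (w \in _)) => [/set_mem/aliveE[_ _ tS]|_].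
  by rewrite /= ltW.
by rewrite /= ltW.
Qed.

(** If the first return of the jump chain to [x] is by jump number [n], then
    [jump_time S n w] is at least the return time: the process has left [x] at
    the first jump, and [n > 1].  If the jump chain never returns, then all the
    inner series are at least 1 and the right-hand side is infinite. *)
Lemma return_time_le x w : Y 0 w = x -> Y 1 w <> x ->
  (return_time X x w <=
   \sum_(i <oo) \sum_(k <oo) (\1_(alive x x i k%:R) w : R)%:E)%E.
Proof.
move=> Y0 Y1.
pose u i : \bar R := (\sum_(k <oo) (\1_(alive x x i k%:R) w : R)%:E)%E.
have ind0 i k : (0 <= (\1_(alive x x i k%:R) w)%:E :> \bar R)%E.
  by rewrite lee_fin.
have u0 i : (0 <= u i)%E by exact: nneseries_ge0.
have Su i : (forall j, (0 < j <= i)%N -> Y j w <> x) -> (S i w <= u i)%E.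
  move=> Yi; apply: le_trans (le_layers (ltW (S_gt0 i w))) _.
  apply: lee_nneseries => [k _ _|k _]; first by rewrite lee_fin.
  rewrite lee_fin indicE ler_nat.
  by case: ltP => // kS; rewrite mem_set //; apply/aliveE; split.
have u1 i : (forall j, (0 < j <= i)%N -> Y j w <> x) -> (1 <= u i)%E.
  move=> Yi; apply: le_trans (le_nneseries 1 (ind0 i)).
  rewrite big_ord1 lee_fin indicE mem_set //; apply/aliveE; split => //.
have [exn|never] := pselect (exists n, (0 < n)%N && (Y n w == x)); last first.
  rewrite [leRHS]ereal_unbounded_pinfty ?leey // => n.
  apply: le_trans (le_nneseries n u0).
  apply: (@le_trans _ _ (\sum_(i < n) 1%:E)%E).
    by rewrite sumEFin sumr_const card_ord.
  apply: lee_sum => i _; apply: u1 => j /andP[j0 _] Yj.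
  by apply: never; exists j; rewrite j0 Yj eqxx.
have [n /andP[n0 /eqP Yn] nmin] := ex_minnP exn.
have Ylt j : (0 < j < n)%N -> Y j w <> x.
  move=> /andP[j0 jn] Yj; have := nmin j; rewrite j0 Yj eqxx => /(_ isT).
  by rewrite leqNgt jn.
have n1 : (1 < n)%N.
  by rewrite ltn_neqAle n0 andbT; apply/eqP => n1; apply: Y1; rewrite n1.
apply: (@le_trans _ _ (jump_time S n w)); last first.
  apply: le_trans (le_nneseries n u0); apply: lee_sum => i _.
  apply: Su => j /andP[j0 ji]; apply: Ylt; rewrite j0.
  exact: leq_ltn_trans (ltn_ord i).
case Jn : (jump_time S n w) (jump_time_ge0 n w) => [t| |]; rewrite ?leey //.
move=> t0; apply: ge_ereal_inf; exists t%:E => //=; exists t => //.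
split; first by rewrite (X_at_jump_time Jn) Yn.
have lt1n : (jump_time S 1 w < jump_time S n w)%E.
  apply: lt_le_trans (jump_time_homo w n1); rewrite (jump_timeS 1) lteDl //.
  rewrite ge0_fin_numE ?jump_time_ge0 //.
  by rewrite (le_lt_trans (jump_time_homo w n0)) // Jn ltry.
rewrite Jn in lt1n.
case J1 : (jump_time S 1 w) (jump_time_ge0 1 w) lt1n => [s| |] //.
rewrite lte_fin lee_fin => s0 st; exists s; first by rewrite st andbT.
by rewrite (X_at_jump_time J1) => -[].
Qed.

End ReturnTime.

(** * Ergodicity and recurrence from the drift of a function *)

Section Ergodicity.
Context {R : realType} {E : countType} {d : measure_display}
  {Omega : measurableType d}.
Variables (q : E -> E -> R) (succ : E -> seq E).
Hypothesis lfq : locally_finite_rates q succ.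
Variables (c C : R).
Hypothesis c_gt0 : 0 < c.
Hypothesis exit_ge : forall x, c <= exit_rate q x.
Hypothesis exit_le : forall x, exit_rate q x <= C.
Variables (P : E -> probability Omega R) (X : R -> Omega -> option E).
Hypothesis XP : minimal_process q P X.

Local Notation J := (jump_matrix q).

Let exit_gt0 x : 0 < exit_rate q x.
Proof. exact: lt_le_trans (exit_ge x). Qed.

Let J_ge0 x y : 0 <= J x y.
Proof. exact: jump_matrix_ge0 lfq exit_gt0 x y. Qed.

Let J_sum1 x : \sum_(y <- succ x) J x y = 1.
Proof. exact: jump_matrix_sum1 lfq exit_gt0 x. Qed.

(** Each holding time exceeds 1 with probability at least [expR (- C)], so the
    mean return time is at least [expR (- C)] times the mean number of jumps. *)
Lemma return_time_avoid_summable x : (\int[P x]_w return_time X x w < +oo)%E ->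
  exists B, forall n, \sum_(i < n) avoid J succ x i x <= B.
Proof.
move=> fin_int; case: XP => _ [Y [S [law X_jump X_expl]]].
exists (expR C * fine (\int[P x]_w return_time X x w)) => n.
rewrite -ler_pdivrMl ?expR_gt0 // -expRN.
have int_ge0 : (0 <= \int[P x]_w return_time X x w)%E.
  by apply: integral_ge0 => w _; exact: return_time_ge0.
rewrite -lee_fin fineK ?ge0_fin_numE //.
apply: (@le_trans _ _ (\sum_(i < n) P x (alive Y S x x i 1))%E).
  rewrite mulr_sumr -sumEFin; apply: lee_sum => i _.
  exact: (alive_ge lfq c_gt0 exit_ge exit_le law).
have -> : (\sum_(i < n) P x (alive Y S x x i 1))%E =
  (\int[P x]_w \sum_(i < n) (\1_(alive Y S x x i 1) w)%:E)%E.
  rewrite ge0_integral_sum //.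
  - apply: eq_bigr => i _; rewrite integral_indic // ?setIT //.
    exact: measurable_alive law _ _ _ _.
  - move=> i; apply/measurable_EFinP; apply: measurable_indic.
    exact: measurable_alive law _ _ _ _.
apply: ge0_le_lower_integral => w.
  by apply: sume_ge0 => i _; rewrite lee_fin.
exact: (alive_sum_le_return_time law X_jump X_expl).
Qed.

(** The mean of a holding time, rounded up, is at most [(1 - expR (- c))^-1], so
    the mean return time is at most a multiple of the mean number of jumps. *)
Lemma avoid_summable_return_time x :
  (exists B, forall n, \sum_(i < n) avoid J succ x i x <= B) ->
  (\int[P x]_w return_time X x w < +oo)%E.
Proof.
move=> [B avoid_le]; case: XP => _ [Y [S [law X_jump X_expl]]].
pose ev i k := alive Y S x x i k%:R.
have mev i k : measurable (ev i k) by exact: measurable_alive law _ _ _ _.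
(* A null set where [return_time_le] does not apply.  Its indicator is added to
   every term of the series [M], so that [M] is infinite there. *)
pose N := ~` follows Y 0 (fun=> x) `|` follows Y 1 (fun=> x).
have mN : measurable N.
  apply: measurableU; [apply: measurableC|]; exact: measurable_follows law _ _.
have N0 : P x N = 0%E.
  have leN : (P x N <= P x (~` follows Y 0 (fun=> x)) +
                       P x (follows Y 1 (fun=> x)))%E.
    apply: measureU2; [apply: measurableC|]; exact: measurable_follows law _ _.
  apply/eqP; rewrite -measure_le0; apply: le_trans leN _.
  rewrite probability_setC; last exact: measurable_follows law _ _.
  rewrite !(follows_law law) /follows_prob eqxx big_ord0 big_ord1 !mul1r.
  by rewrite (jump_matrixE exit_gt0) eqxx -EFinB subrr adde0.
have ind0 (A : set Omega) w : (0 <= (\1_A w : R)%:E)%E by rewrite lee_fin.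
pose u i w : \bar R := (\sum_(k <oo) (\1_(ev i k) w : R)%:E)%E.
have u0 i w : (0 <= u i w)%E by exact: nneseries_ge0.
pose M w : \bar R := (\sum_(i <oo) ((\1_N w)%:E + u i w))%E.
have mind (A : set Omega) : measurable A ->
    measurable_fun setT (fun w => (\1_A w : R)%:E).
  by move=> mA; apply/measurable_EFinP; exact: measurable_indic.
have int_ind (A : set Omega) : measurable A ->
    (\int[P x]_w (\1_A w : R)%:E)%E = P x A.
  by move=> mA; rewrite integral_indic // setIT.
have mu i : measurable_fun setT (u i).
  by apply: ge0_emeasurable_sum => // k _; exact: mind.
have le_M w : (return_time X x w <= M w)%E.
  have [Nw|Nw] := boolP (w \in N).
    rewrite [leRHS]ereal_unbounded_pinfty ?leey // => n.
    have v0 i : (0 <= (\1_N w)%:E + u i w)%E by rewrite adde_ge0.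
    apply: le_trans (le_nneseries n v0).
    apply: (@le_trans _ _ (\sum_(i < n) 1%:E)%E).
      by rewrite sumEFin sumr_const card_ord.
    by apply: lee_sum => i _; rewrite indicE Nw leeDl.
  have [Y0 Y1] : Y 0 w = x /\ Y 1 w <> x.
    move: Nw; rewrite notin_setE => Nw; split.
      apply: contrapT => Y0; apply: Nw; left => /(_ 0%N (leqnn _)).
      exact: Y0.
    move=> Y1; apply: Nw; have [Y0|Y0] := eqVneq (Y 0 w) x; [right|left].
      by case=> [|[|i]].
    by move=> /(_ 0%N (leqnn _)) /eqP; rewrite (negPf Y0).
  apply: le_trans (return_time_le law X_jump Y0 Y1) _.
  apply: lee_nneseries => [i _ _|i _]; first exact: u0.
  by rewrite leeDr.
apply: (@le_lt_trans _ _ (\int[P x]_w M w)%E).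
  apply: (@ge0_le_lower_integral _ _ _ (P x)) => w; last exact: le_M.
  exact: return_time_ge0.
have z1 : 0 < 1 - expR (- c) by rewrite subr_gt0 expR_lt1 oppr_lt0.
apply: (@le_lt_trans _ _ ((1 - expR (- c))^-1 * B)%:E); last exact: ltry.
rewrite integral_nneseries //; last first.
- by move=> i w _; rewrite adde_ge0.
- by move=> i; apply: emeasurable_funD => //; exact: mind.
apply: nneseries_le => [i|n].
  by apply: integral_ge0 => w _; rewrite adde_ge0.
apply: (@le_trans _ _
  (\sum_(i < n) ((1 - expR (- c))^-1 * avoid J succ x i x)%:E)%E).
  apply: lee_sum => i _.
  rewrite ge0_integralD //; last exact: mind.
  rewrite int_ind // N0 add0e integral_nneseries //; last first.
    by move=> k; exact: mind.
  apply: nneseries_le => [k|m]; first by apply: integral_ge0.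
  apply: (@le_trans _ _
    (\sum_(k < m) (expR (- c) ^+ k * avoid J succ x i x)%:E)%E).
    apply: lee_sum => k _; rewrite int_ind //.
    exact: (alive_le lfq c_gt0 exit_ge law).
  rewrite sumEFin lee_fin -mulr_suml ler_wpM2r ?avoid_ge0 //.
  have := @geometric_le_lim R m 1 (expR (- c)) ler01 (expR_gt0 _).
  rewrite ger0_norm ?expR_ge0 // -subr_gt0 z1 => /(_ isT).
  rewrite mul1r; apply: le_trans; rewrite /series /= big_mkord.
  by apply: ler_sum => k _; rewrite mul1r.
rewrite sumEFin lee_fin -mulr_sumr ler_wpM2l // invr_ge0; exact: ltW.
Qed.

(** The visited states are those the jump chain reaches after finite times, which
    makes the event a countable union. *)
Lemma measurable_visits y :
  measurable [set w | exists2 t : R, 0 <= t & X t w = Some y].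
Proof.
case: XP => _ [Y [S [law X_jump X_expl]]].
have [mY mS S0 _] := law.
rewrite [X in measurable X](_ : _ = \bigcup_n ([set w | Y n w = y] `&`
   [set w | (jump_time S n w < +oo)%E])).
  apply: bigcupT_measurable => n; apply: measurableI => //.
  rewrite -[X in measurable X]setTI; apply: emeasurable_fun_infty_o => //.
  exact: emeasurable_sum.
apply/seteqP; split=> w /=.
  move=> [t t0 /(X_eq_Some X_jump X_expl t0) [n [/andP[nt _] Yn]]].
  by exists n => //; split=> //=; rewrite (le_lt_trans nt) ?ltry.
move=> [n _ [/= Yn]].
case Jn : (jump_time S n w) (jump_time_ge0 law n w) => [t| |] // t0 _.
exists t; first by rewrite -lee_fin.
by rewrite (X_at_jump_time law X_jump Jn) Yn.
Qed.

(** With positive probability the jump chain hits [y] within [m] steps.  Almost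
    surely the holding times before the hit are finite, so that the process is
    in [y] when the jump chain gets there. *)
Lemma irreducible_of_reaches :
  (forall x y, reaches J succ y x) -> irreducible P X.
Proof.
move=> reach x y; have mA := measurable_visits y.
case: (XP) => _ [Y [S [law X_jump X_expl]]].
set A := [set w | _] in mA *.
have [m ym] := reach x y.
pose ev i t := alive Y S y x i t.
have mev i t : measurable (ev i t) by exact: measurable_alive law _ _ _ _.
(* An infinite holding time before the visit to [y]; being infinite is written
   as exceeding all integers, to which the law of [alive] applies. *)
pose stuck i := \bigcap_k ev i k%:R.
have mstuck i : measurable (stuck i) by exact: bigcapT_measurable.
have stuck0 i : P x (stuck i) = 0%E.
  have stuck_le k : (P x (stuck i) <= (expR (- c) ^+ k)%:E)%E.
    apply: (@le_trans _ _ (P x (ev i k%:R))).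
      by apply: le_measure; rewrite ?inE //; exact: bigcap_inf.
    apply: le_trans (alive_le lfq c_gt0 exit_ge law y x i k) _.
    by rewrite lee_fin ler_piMr ?exprn_ge0 ?expR_ge0 // avoid_le1.
  have [p pE] : exists p, P x (stuck i) = p%:E.
    by exists (fine (P x (stuck i))); rewrite fineK // fin_num_measure.
  have p0 : 0 <= p by rewrite -lee_fin -pE.
  rewrite pE; congr EFin; apply/eqP; rewrite eq_le p0 andbT.
  have z0 : (expR (- c) ^+ k @[k --> \oo] --> (0 : R))%classic.
    by apply: cvg_expr; rewrite ger0_norm ?expR_ge0 // expR_lt1 oppr_lt0.
  apply: (ler_cvg_to (cvg_cst p) z0).
  by apply: nearW => k; rewrite -lee_fin -pE.
pose null := ~` follows Y 0 (fun=> x) `|` \bigcup_i stuck i.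
have mfol : measurable (follows Y 0 (fun=> x)).
  exact: measurable_follows law _ _.
have mbig : measurable (\bigcup_i stuck i) by exact: bigcupT_measurable.
have mnull : measurable null by apply: measurableU => //; exact: measurableC.
have start0 : P x (~` follows Y 0 (fun=> x)) = 0%E.
  rewrite probability_setC // (follows_law law) /follows_prob eqxx big_ord0.
  by rewrite !mul1r -EFinB subrr.
have stuck_any0 : P x (\bigcup_i stuck i) = 0%E.
  apply/(negligibleP (P x) mbig); apply: negligible_bigcup => i.
  by apply/negligibleP; [exact: mstuck|exact: stuck0].
have null0 : P x null = 0%E.
  by apply: null_set_setU => //; exact: measurableC.
have sub : ~` ev m 0 `<=` A `|` null.
  move=> w not_avoid; have [Nw|Nw] := pselect (null w); [by right|left].
  have Y0 : Y 0 w = x.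
    apply: contrapT => Y0; apply: Nw; left => /(_ 0%N (leqnn _)); exact: Y0.
  have ex_hit : exists n, (0 < n <= m)%N && (Y n w == y).
    apply: contrapT => never; apply: not_avoid; split; last first.
      by have [_ _ S0 _] := law; exact: S0.
    split=> [i|j]; first by rewrite leqn0 => /eqP ->.
    by rewrite add0n => jm Yj; apply: never; exists j; rewrite jm Yj eqxx.
  have [n /andP[/andP[n0 nm] /eqP Yn] nmin] := ex_minnP ex_hit.
  have finS i : (i < n)%N -> (S i w < +oo)%E.
    move=> i_n; rewrite ltey; apply/eqP => Si; apply: Nw; right.
    exists i => // k _.
    split; last by rewrite /= add0n Si ltry.
    split=> [l|j]; first by rewrite leqn0 => /eqP ->.
    rewrite add0n => /andP[j0 ji] Yj; have jn := leq_ltn_trans ji i_n.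
    have := nmin j; rewrite j0 (leq_trans (ltnW jn) nm) Yj eqxx => /(_ isT).
    by rewrite leqNgt jn.
  have finJ : (jump_time S n w < +oo)%E.
    by rewrite /jump_time; apply: lte_sum_pinfty => i _; exact: finS.
  case Jn : (jump_time S n w) (jump_time_ge0 law n w) finJ => [t| |] // t0 _.
  exists t; first by rewrite -lee_fin.
  by rewrite (X_at_jump_time law X_jump Jn) Yn.
have : (P x (~` ev m 0%R) <= P x A)%E.
  have : (P x (~` ev m 0%R) <= P x (A `|` null))%E.
    apply: le_measure; rewrite ?inE //; first exact: measurableC.
    exact: measurableU.
  by move/le_trans; apply; rewrite measureU0.
apply: lt_le_trans; rewrite probability_setC //.
rewrite (alive_law lfq c_gt0 exit_ge law) // -EFinB lte_fin subr_gt0.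
apply: le_lt_trans ym; rewrite /avoid.
by apply: le_iter_taboo => // z; rewrite mulr0 oppr0 expR0.
Qed.

Definition generator (f : E -> R) (x : E) : R :=
  \sum_(y <- succ x) q x y * (f y - f x).

Lemma mean_generator f x :
  mean J succ f x = f x + generator f x / exit_rate q x.
Proof.
rewrite -[X in _ = X + _]mul1r -(J_sum1 x) !mulr_suml -big_split /=.
rewrite /mean big_seq [RHS]big_seq; apply: eq_bigr => y yx.
rewrite (jump_matrix_succ lfq exit_gt0 yx); ring.
Qed.

(** Dividing by the exit rate turns a drift of the process into one of its jump
    chain; as the exit rates lie between [c] and [C], bounds are kept up to
    constants.  On the finite set [F] any drift is bounded. *)
Theorem ergodic_of_drift (V : E -> R) (F : seq E) (eps : R) :
  0 < eps -> (forall x, 0 <= V x) -> (forall x y, reaches J succ y x) ->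
  (forall x, x \notin F -> generator V x <= - eps) ->
  ergodic P X.
Proof.
move=> eps0 V0 reach drift; split; first exact: irreducible_of_reaches.
move=> a; apply: avoid_summable_return_time.
pose g := \sum_(y <- F) `|generator V y|.
have g0 : 0 <= g by apply: sumr_ge0.
have C0 : 0 < C by exact: lt_le_trans (exit_le a).
have bc0 : 0 <= g / c by rewrite divr_ge0 // ltW.
have ec0 : 0 < eps / C by rewrite divr_gt0.
apply: (@avoid_summable_of_drift _ _ J succ a J_ge0 J_sum1 V F
  (eps / C) (g / c + eps / C)) => //.
  by rewrite addr_ge0 // ltW.
move=> x; rewrite mean_generator -addrA lerD2l.
have [xF|xF] := boolP (x \in F).
  rewrite mulr1 addrCA addNr addr0 ler_pdivrMr //.
  have le_g : generator V x <= g.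
    rewrite /g (big_rem x) //= (le_trans (ler_norm _)) // lerDl.
    by apply: sumr_ge0.
  apply: le_trans le_g _; rewrite -mulrA ler_peMr //.
  by rewrite ler_pdivlMl // mulr1.
rewrite mulr0 addr0 ler_pdivrMr // mulNr.
apply: le_trans (drift _ xF) _; rewrite lerN2 mulrAC ler_pdivrMr //.
by rewrite ler_pM2l.
Qed.

Theorem not_positive_recurrent_of_drift (h : E -> R) (a : E) (B : R) :
  h a = 0 -> (forall x, 0 <= generator h x) -> 0 < generator h a ->
  (forall x y, y \in succ x -> h y <= h x + B) ->
  ~ positive_recurrent P X.
Proof.
move=> ha0 sub_h drift_a incr /(_ a)/return_time_avoid_summable.
apply: (avoid_not_summable_of_submartingale J_ge0 ha0 _ _ incr).
  by move=> x; rewrite mean_generator lerDl divr_ge0 // ltW.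
by rewrite mean_generator ha0 add0r divr_gt0.
Qed.

End Ergodicity.

(** * The transitions of the tandem queue *)

Section TandemRates.
Context {R : realType}.
Variables (lambda : nat -> R) (mu1 mu2 : R).
Hypothesis lambda_ge0 : forall n, 0 <= lambda n.
Hypothesis mu1_gt0 : 0 < mu1.
Hypothesis mu2_gt0 : 0 < mu2.

Local Notation q := (tandem_rate lambda mu1 mu2).

Definition tandem_succ (x : nat * nat) : seq (nat * nat) :=
  [:: (x.1.+1, x.2)]
  ++ (if (0 < x.1)%N then [:: (x.1.-1, x.2.+1)] else [::])
  ++ (if (0 < x.2)%N then [:: (x.1, x.2.-1)] else [::]).

Lemma tandem_arrival m n : q (m, n) (m.+1, n) = lambda n.
Proof. by rewrite /tandem_rate eqxx. Qed.

Lemma tandem_service1 m n : q (m.+1, n) (m, n.+1) = mu1.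
Proof.
rewrite /tandem_rate /= !xpair_eqE !eqxx /=.
by case: ifP => // /andP[/eqP]; lia.
Qed.

Lemma tandem_service2 m n : q (m, n.+1) (m, n) = mu2.
Proof.
rewrite /tandem_rate /= !xpair_eqE !eqxx /=.
case: ifP => [/andP[/eqP]|_]; first by lia.
by case: ifP => // /and3P[_ _ /eqP]; lia.
Qed.

Lemma tandem_succ_sum (f : nat * nat -> R) x :
  \sum_(y <- tandem_succ x) q x y * f y =
  lambda x.2 * f (x.1.+1, x.2)
  + (if (0 < x.1)%N then mu1 * f (x.1.-1, x.2.+1) else 0)
  + (if (0 < x.2)%N then mu2 * f (x.1, x.2.-1) else 0).
Proof.
case: x => [[|m] [|n]] /=; rewrite /tandem_succ /= !big_cons big_nil;
  by rewrite ?tandem_arrival ?tandem_service1 ?tandem_service2 ?addr0 ?addrA.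
Qed.

Lemma tandem_locally_finite : locally_finite_rates q tandem_succ.
Proof.
split=> [x y _|[[|m] [|n]]|[[|m] [|n]]|x y _].
- by rewrite /tandem_rate; do 3?[case: ifP => _ //]; rewrite ?ltW.
- by [].
- by rewrite /tandem_succ /= ?inE ?xpair_eqE; lia.
- by rewrite /tandem_succ /= ?inE ?xpair_eqE; lia.
- by rewrite /tandem_succ /= ?inE ?xpair_eqE; lia.
- by rewrite /tandem_succ /= ?inE ?xpair_eqE; lia.
- by rewrite /tandem_succ /= ?inE ?xpair_eqE; lia.
- by rewrite /tandem_succ /= ?inE ?xpair_eqE; lia.
- by rewrite /tandem_succ /= ?inE ?xpair_eqE; lia.
rewrite /tandem_succ /tandem_rate.
rewrite !mem_cat !inE !negb_or => /and3P[/negPf-> H1 H2].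
have -> : (0 < x.1)%N && (y == (x.1.-1, x.2.+1)) = false.
  by apply: contraNF H1 => /andP[-> /eqP->]; rewrite inE.
rewrite (_ : _ && _ = false) //.
by apply: contraNF H2 => /andP[-> /eqP->]; rewrite inE.
Qed.

Lemma tandem_exit_rate x : exit_rate q x =
  lambda x.2 + (if (0 < x.1)%N then mu1 else 0)
  + (if (0 < x.2)%N then mu2 else 0).
Proof.
rewrite (exit_rate_sum tandem_locally_finite).
have := tandem_succ_sum (fun=> 1) x; rewrite !mulr1 => <-.
by under [RHS]eq_bigr do rewrite mulr1.
Qed.

Lemma tandem_generator (g : nat -> R) x :
  generator q tandem_succ (fun x => x.1%:R + g x.2) x =
  lambda x.2 + (if (0 < x.1)%N then mu1 * (g x.2.+1 - g x.2 - 1) else 0)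
  - (if (0 < x.2)%N then mu2 * (g x.2 - g x.2.-1) else 0).
Proof.
rewrite /generator tandem_succ_sum.
case: x => [[|m] [|n]] /=; rewrite ?subr0 ?addr0 -?natr1; ring.
Qed.

Hypothesis lambda0_gt0 : 0 < lambda 0.

Lemma tandem_exit_rate_ge x :
  Num.min (lambda 0) (Num.min mu1 mu2) <= exit_rate q x.
Proof.
rewrite tandem_exit_rate !ge_min.
case: x => [[|m] [|n]] /=; rewrite ?addr0.
- by rewrite lexx.
- by rewrite lerDr lambda_ge0 !orbT.
- by rewrite lerDr lambda_ge0 !orbT.
- by rewrite lerDr addr_ge0 ?lambda_ge0 ?orbT // ltW.
Qed.

Lemma tandem_exit_rate_gt0 x : 0 < exit_rate q x.
Proof.
apply: lt_le_trans (tandem_exit_rate_ge x).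
by rewrite !lt_min lambda0_gt0 mu1_gt0.
Qed.

Lemma tandem_step a x y : y \in tandem_succ x -> 0 < q x y ->
  y = a \/ reaches (jump_matrix q) tandem_succ a y ->
  reaches (jump_matrix q) tandem_succ a x.
Proof.
move=> yx qxy.
apply: (reaches_step
  (jump_matrix_ge0 tandem_locally_finite tandem_exit_rate_gt0)
  (jump_matrix_sum1 tandem_locally_finite tandem_exit_rate_gt0) yx).
rewrite (jump_matrix_succ tandem_locally_finite tandem_exit_rate_gt0 yx).
by rewrite divr_gt0 // tandem_exit_rate_gt0.
Qed.

Lemma tandem_reaches a x : reaches (jump_matrix q) tandem_succ a x.
Proof.
pose reach y := reaches (jump_matrix q) tandem_succ a y.
pose reach0 y := y = a \/ reach y.
have arrive n : reach0 (n.+1, 0)%N -> reach (n, 0)%N.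
  by apply: tandem_step; rewrite ?tandem_arrival // !inE eqxx.
have serve1 m n : reach0 (m, n.+1) -> reach (m.+1, n).
  apply: tandem_step; rewrite ?tandem_service1 // /tandem_succ.
  by rewrite !inE eqxx orbT.
have serve2 m n : reach0 (m, n) -> reach (m, n.+1).
  apply: tandem_step; rewrite ?tandem_service2 // /tandem_succ.
  by rewrite mem_cat mem_cat /= !inE eqxx !orbT.
(* Backwards from a: through the states with a.1 + a.2 customers to
   (a.1 + a.2, 0), down to the empty state, which every state can reach. *)
have fill j : (j <= a.2)%N -> reach0 (a.1 + j, a.2 - j)%N.
  elim: j => [|j IHj] ja.
    by left; rewrite addn0 subn0 -surjective_pairing.
  right; rewrite addnS; apply: serve1; rewrite subnSK //; exact: IHj (ltnW ja).
have top : reach0 (a.1 + a.2, 0)%N by have := fill _ (leqnn a.2); rewrite subnn.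
have empty : reach0 (0, 0)%N.
  move: top; elim: (a.1 + a.2)%N => // n IHn /arrive reach_n; apply: IHn.
  by right.
have all0 m n : reach0 (m, n).
  elim: m n => [|m IHm] n; last by right; apply: serve1; exact: IHm.
  by elim: n => // n IHn; right; exact: serve2.
case: x => [[|m] [|n]].
- exact: arrive.
- exact: serve2.
- exact: serve1.
- exact: serve1.
Qed.

End TandemRates.

(** * The stability criterion *)

Section Slope.
Context {R : realType}.
Variable lambda : nat -> R.
Hypothesis lambda_nonincreasing :
  forall m n, (m <= n)%N -> lambda n <= lambda m.

(** The increments that a function [x.1 + g x.2] must have in the second
    coordinate to have mean drift [- eps] where the first queue is not empty. *)
Fixpoint slope (mu1 mu2 eps : R) (n : nat) : R :=
  (mu2 * (if n is n'.+1 then slope mu1 mu2 eps n' else 0)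
   + mu1 - eps - lambda n) / mu1.

Lemma slopeE mu1 mu2 eps n : 0 < mu1 ->
  mu1 * slope mu1 mu2 eps n =
  mu2 * (if n is n'.+1 then slope mu1 mu2 eps n' else 0) + mu1 - eps - lambda n.
Proof. by move=> m1; case: n => [|n] /=; rewrite mulrC divfK // gt_eqF. Qed.

Lemma slope_affine mu1 mu2 n : 0 < mu1 ->
  exists w, forall eps, slope mu1 mu2 eps n = slope mu1 mu2 0 n - eps * w.
Proof.
move=> m1; have m1' : mu1 != 0 by rewrite gt_eqF.
elim: n => [|n [w wE]].
  by exists (mu1^-1) => eps /=; field.
by exists ((mu2 * w + 1) / mu1) => eps /=; rewrite wE; field.
Qed.

(** A sign change of the slope from nonpositive to positive at [n] needs
    [lambda n < mu1], which then persists. *)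
Lemma slope_gt0_lambda mu1 mu2 n : 0 < mu1 -> 0 < mu2 ->
  0 < slope mu1 mu2 0 n -> lambda n < mu1.
Proof.
move=> m1 m2; elim: n => [|n IHn].
  by rewrite -(pmulr_rgt0 _ m1) slopeE // mulr0; lra.
rewrite -(pmulr_rgt0 _ m1) slopeE // => dS.
have [/IHn ln|dn] := ltP 0 (slope mu1 mu2 0 n).
  exact: le_lt_trans (lambda_nonincreasing (leqnSn n)) ln.
have : mu2 * slope mu1 mu2 0 n <= 0 by rewrite mulr_ge0_le0 // ltW.
by move: dS; lra.
Qed.

Lemma slope_gt0_up mu1 mu2 m n : 0 < mu1 -> 0 < mu2 -> (m <= n)%N ->
  0 < slope mu1 mu2 0 m -> 0 < slope mu1 mu2 0 n.
Proof.
move=> m1 m2 /subnK <-; elim: (n - m)%N => // k IHk dm; have dk := IHk dm.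
rewrite addSn -(pmulr_rgt0 _ m1) slopeE //.
have lk := le_lt_trans (lambda_nonincreasing (leqnSn _))
  (slope_gt0_lambda m1 m2 dk).
by have := mulr_gt0 m2 dk; lra.
Qed.

(** If the slopes for [mu1'] are nonpositive, then they dominate those for [mu1]:
    in [slope n = 1 + (mu2 * slope (n - 1) - lambda n) / mu1] the numerator is
    nonpositive, so increasing [mu1] increases the right-hand side. *)
Lemma slope_gt0_mono mu1 mu1' mu2 : 0 < mu1 -> 0 < mu2 -> mu1 <= mu1' ->
  (forall n, 0 <= lambda n) ->
  (exists n, 0 < slope mu1 mu2 0 n) -> exists n, 0 < slope mu1' mu2 0 n.
Proof.
move=> m1 m2 m11' l0 [n dn]; apply: contrapT => /forallNP no.
have d'_le0 k : slope mu1' mu2 0 k <= 0 by rewrite leNgt; exact/negP.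
have m1' : 0 < mu1' by exact: lt_le_trans m11'.
have le_slope k : slope mu1 mu2 0 k <= slope mu1' mu2 0 k.
  have inv_le : mu1'^-1 <= mu1^-1 by rewrite lef_pV2.
  have step a a' : a <= a' -> a' <= 0 -> forall l, 0 <= l ->
      (mu2 * a + mu1 - 0 - l) / mu1 <= (mu2 * a' + mu1' - 0 - l) / mu1'.
    move=> aa' a'0 l l_ge0.
    have -> : (mu2 * a + mu1 - 0 - l) / mu1 = 1 + (mu2 * a - l) / mu1.
      by field; rewrite gt_eqF.
    have -> : (mu2 * a' + mu1' - 0 - l) / mu1' = 1 + (mu2 * a' - l) / mu1'.
      by field; rewrite gt_eqF.
    rewrite lerD2l; apply: (@le_trans _ _ ((mu2 * a' - l) / mu1)).
      by rewrite ler_pM2r ?invr_gt0 // lerD2r ler_pM2l.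
    rewrite ler_wnM2l // subr_le0; apply: le_trans l_ge0.
    by rewrite mulr_ge0_le0 // ltW.
  elim: k => [|k IHk] /=; exact: step.
by have := lt_le_trans dn (le_slope n); rewrite ltNge d'_le0.
Qed.

End Slope.

Lemma partial_sums_bounded_below {R : realType} (M : nat) (D : nat -> R) :
  (forall k, (M <= k)%N -> 0 <= D k) ->
  exists K, forall n, 0 <= K + \sum_(k < n) D k.
Proof.
elim: M D => [|M IHM] D D0.
  by exists 0 => n; rewrite add0r; apply: sumr_ge0 => k _; exact: D0.
have [K KP] := IHM (fun k => D k.+1) (fun k Mk => D0 k.+1 Mk).
exists (`|D 0%N| + K) => -[|n].
  by have := KP 0%N; rewrite !big_ord0 !addr0 => K0; rewrite addr_ge0.
rewrite big_ord_recl; have := KP n; have := ler_norm (- D 0%N); rewrite normrN.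
by rewrite /=; lra.
Qed.

(** * Stability of the tandem queue *)

Section TandemStability.
Context {R : realType}.
Variables (lambda : nat -> R) (mu1 mu2 : R).
Hypothesis lambda_ge0 : forall n, 0 <= lambda n.
Hypothesis mu1_gt0 : 0 < mu1.
Hypothesis mu2_gt0 : 0 < mu2.
Hypothesis lambda_nonincreasing :
  forall m n, (m <= n)%N -> lambda n <= lambda m.
Hypothesis lambda_eventually0 : exists N, forall n, (N <= n)%N -> lambda n = 0.
Context {d : measure_display} {Omega : measurableType d}.
Variables (P : nat * nat -> probability Omega R)
  (X : R -> Omega -> option (nat * nat)).

Local Notation q := (tandem_rate lambda mu1 mu2).
Hypothesis XP : minimal_process q P X.

Lemma tandem_exit_rate_le x : exit_rate q x <= lambda 0 + mu1 + mu2.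
Proof.
rewrite tandem_exit_rate //; apply: lerD; last by case: ifP => // _; exact: ltW.
by apply: lerD; [exact: lambda_nonincreasing|case: ifP => // _; exact: ltW].
Qed.

(** If [lambda 0 = 0], then the empty state is absorbing. *)
Lemma irreducible_lambda0 : irreducible P X -> 0 < lambda 0.
Proof.
move=> irr; rewrite lt_neqAle lambda_ge0 andbT; apply/eqP => l0.
have exit0 : exit_rate q (0, 0)%N = 0.
  by rewrite tandem_exit_rate //= -l0 !addr0.
have J0 : jump_matrix q (0, 0)%N (0, 0)%N = 1.
  by rewrite /jump_matrix exit0 !eqxx.
have mA := measurable_visits XP (1, 0)%N.
have := irr (0, 0)%N (1, 0)%N.
case: XP => _ [Y [S [law X_jump X_expl]]].
set A := [set w | _] in mA *.
pose F n := follows Y n (fun=> (0, 0)%N).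
have mF n : measurable (F n) by exact: measurable_follows law _ _.
have mF' : measurable (\bigcup_n ~` F n).
  by apply: bigcupT_measurable => n; exact: measurableC.
have PF n : P (0, 0)%N (~` F n) = 0%E.
  rewrite probability_setC // (follows_law law) /follows_prob eqxx mul1r.
  by rewrite big1 => [|i _]; rewrite ?J0 // -EFinB subrr.
have PF' : P (0, 0)%N (\bigcup_n ~` F n) = 0%E.
  apply/(negligibleP _ mF'); apply: negligible_bigcup => n.
  by apply/negligibleP; [exact: measurableC|exact: PF].
rewrite (_ : P (0, 0)%N A = 0%E) ?ltxx //.
apply: (subset_measure0 mA mF' _ PF') => w /= [t t0].
move=> /(X_eq_Some X_jump X_expl t0) [n [_ Yn]]; exists n => //=.
by move=> /(_ n (leqnn n)); rewrite Yn.
Qed.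

(** The Lyapunov function is [x.1 + g x.2], where [g] has the increments
    [slope eps] up to [M] and [delta] afterwards.  Its drift is [- eps] or less
    if [x.1 > 0]; if [x.1 = 0] and [x.2 > M + 1], then there are no arrivals and
    the drift is [- mu2 * delta]. *)
Lemma slope_gt0_ergodic : 0 < lambda 0 ->
  (exists n, 0 < slope lambda mu1 mu2 0 n) -> ergodic P X.
Proof.
move=> l0 [n dn]; have [N lN] := lambda_eventually0.
pose M := maxn n N.
have dM : 0 < slope lambda mu1 mu2 0 M.
  exact: (slope_gt0_up lambda_nonincreasing mu1_gt0 mu2_gt0 (leq_maxl n N) dn).
have lM k : (M <= k)%N -> lambda k = 0.
  by move=> Mk; apply: lN; exact: leq_trans (leq_maxr n N) Mk.
have [w wE] := slope_affine lambda mu2 M mu1_gt0.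
(* Small enough for [slope eps M] to remain positive and for [delta <= 1/2] to
   satisfy [mu1 * delta - mu2 * delta <= mu1 - eps]. *)
pose eps := Num.min (mu1 / 2) (slope lambda mu1 mu2 0 M / (`|w| + 1)).
have w1 : 0 < `|w| + 1 by rewrite ltr_wpDl.
have eps_gt0 : 0 < eps by rewrite lt_min !divr_gt0.
have eps_mu : eps <= mu1 / 2 by rewrite ge_min lexx.
have eps_d : eps * (`|w| + 1) <= slope lambda mu1 mu2 0 M.
  by rewrite -ler_pdivlMr // ge_min lexx orbT.
have eM : 0 < slope lambda mu1 mu2 eps M.
  rewrite wE subr_gt0; apply: lt_le_trans eps_d; rewrite ltr_pM2l //.
  by rewrite (le_lt_trans (ler_norm w)) // ltrDl.
pose delta := Num.min (slope lambda mu1 mu2 eps M) (1 / 2).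
have delta_gt0 : 0 < delta by rewrite lt_min eM divr_gt0.
have delta_e : delta <= slope lambda mu1 mu2 eps M by rewrite ge_min lexx.
have delta_half : delta <= 1 / 2 by rewrite ge_min lexx orbT.
pose D k := if (k <= M)%N then slope lambda mu1 mu2 eps k else delta.
have [K KP] : exists K, forall n, 0 <= K + \sum_(k < n) D k.
  apply: (@partial_sums_bounded_below _ M.+1) => k.
  by rewrite ltnNge /D => /negPf ->; exact: ltW.
pose g k := K + \sum_(i < k) D i.
have gS k : g k.+1 - g k = D k by rewrite /g big_ord_recr /=; ring.
apply: (@ergodic_of_drift _ _ _ _ _ _
  (tandem_locally_finite lambda_ge0 mu1_gt0 mu2_gt0)
  (Num.min (lambda 0) (Num.min mu1 mu2)) (lambda 0 + mu1 + mu2) _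
  (tandem_exit_rate_ge lambda_ge0 mu1_gt0 mu2_gt0)
  tandem_exit_rate_le _ _ XP (fun x => x.1%:R + g x.2)
  [seq (0%N, k) | k <- iota 0 M.+2] (Num.min eps (mu2 * delta))).
- by rewrite !lt_min l0 mu1_gt0.
- by rewrite lt_min eps_gt0 mulr_gt0.
- by move=> x; apply: addr_ge0; [exact: ler0n|exact: KP].
- by move=> x a; exact: tandem_reaches lambda_ge0 mu1_gt0 mu2_gt0 l0 a x.
move=> [[|m] k] xF; rewrite tandem_generator //=.
  have kM : (M.+1 < k)%N.
    rewrite ltnNge; apply: contra xF => kM; apply/mapP; exists k => //.
    by rewrite mem_iota.
  case: k kM {xF} => // k Mk; rewrite ltnS in Mk.
  have -> : lambda k.+1 = 0 by apply: lM; rewrite ltnW // ltnW.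
  have -> : g k.+1 - g k = delta by rewrite gS /D leqNgt Mk.
  by rewrite /= !add0r lerN2 ge_min lexx orbT.
rewrite gS; apply: (@le_trans _ _ (- eps)); last by rewrite lerN2 ge_min lexx.
have [kM|Mk] := leqP k M.
  have Dk : mu1 * D k =
      mu2 * (if k is k'.+1 then D k' else 0) + mu1 - eps - lambda k.
    rewrite /D kM slopeE //; case: k kM {xF} => // k kM.
    by rewrite (ltnW kM).
  case: k Dk {xF kM} => [|k] /= Dk; rewrite ?gS mulrBr Dk mulr1; lra.
case: k Mk {xF} => // k Mk; rewrite /= (gS k) (lM k.+1 (ltnW Mk)).
have -> : D k.+1 = delta by rewrite /D leqNgt Mk.
have Dk : delta <= D k.
  move: Mk; rewrite ltnS leq_eqVlt /D => /predU1P[<-|Mk].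
    by rewrite leqnn.
  by rewrite leqNgt Mk.
have h1 := ler_wpM2l (ltW mu2_gt0) Dk.
have h2 := ler_wpM2l (ltW mu1_gt0) delta_half.
have h3 := mulr_gt0 mu2_gt0 delta_gt0.
rewrite add0r mulrBr mulr1; lra.
Qed.

(** If all slopes are nonpositive, then [x.1 + g x.2] with the increments of [g]
    truncated at [- B] is a submartingale: if [x.1 = 0] then only arrivals and
    departures occur, and as [g] is nonincreasing neither decreases it. *)
Lemma positive_recurrent_slope_gt0 : 0 < lambda 0 -> positive_recurrent P X ->
  exists n, 0 < slope lambda mu1 mu2 0 n.
Proof.
move=> l0 pr; apply: contrapT => /forallNP no.
have d_le0 k : slope lambda mu1 mu2 0 k <= 0 by rewrite leNgt; exact/negP.
have mu12 : mu1 < mu2.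
  rewrite ltNge; apply/negP => mu21; have [N lN] := lambda_eventually0.
  have grow k :
      slope lambda mu1 mu2 0 N + k%:R <= slope lambda mu1 mu2 0 (N + k).
    elim: k => [|k IHk]; first by rewrite addn0 addr0.
    rewrite -natr1 addrA addnS.
    apply: (@le_trans _ _ (slope lambda mu1 mu2 0 (N + k) + 1)).
      by rewrite lerD2r.
    rewrite -(ler_pM2l mu1_gt0) slopeE // lN ?leq_addr //; last by lia.
    have := ler_wnM2r (d_le0 (N + k)%N) mu21.
    by rewrite mulrDr mulr1; lra.
  pose k := (Num.truncn (- slope lambda mu1 mu2 0 N)).+1.
  have := le_trans (grow k) (d_le0 _).
  have := truncnS_gt (- slope lambda mu1 mu2 0 N).
  by rewrite -/k; lra.
(* Chosen such that a constant increment [- B] also gives drift at least 0. *)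
pose B := mu1 / (mu2 - mu1).
have B_gt0 : 0 < B by rewrite divr_gt0 // subr_gt0.
have BE : mu2 * B - mu1 * B = mu1.
  by rewrite -mulrBl mulrC divfK // gt_eqF // subr_gt0.
pose D k := Num.max (slope lambda mu1 mu2 0 k) (- B).
have D_le0 k : D k <= 0 by rewrite ge_max d_le0 oppr_le0 ltW.
have D_geB k : - B <= D k by rewrite le_max lexx orbT.
have D_ge k : slope lambda mu1 mu2 0 k <= D k by rewrite le_max lexx.
pose g k := \sum_(i < k) D i.
have gS k : g k.+1 - g k = D k by rewrite /g big_ord_recr /=; ring.
apply: (@not_positive_recurrent_of_drift _ _ _ _ _ _
  (tandem_locally_finite lambda_ge0 mu1_gt0 mu2_gt0)
  (Num.min (lambda 0) (Num.min mu1 mu2)) (lambda 0 + mu1 + mu2) _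
  (tandem_exit_rate_ge lambda_ge0 mu1_gt0 mu2_gt0)
  tandem_exit_rate_le _ _ XP (fun x => x.1%:R + g x.2) (0, 0)%N (1 + B)) => //.
- by rewrite !lt_min l0 mu1_gt0.
- by rewrite /g big_ord0 addr0.
- move=> [[|m] k]; rewrite tandem_generator //=.
    case: k => [|k] /=; first by rewrite subr0 addr0.
    rewrite gS addr0 subr_ge0 (le_trans _ (lambda_ge0 _)) //.
    by rewrite mulr_ge0_le0 // ltW.
  rewrite gS.
  have Dk :
      mu2 * (if k is k'.+1 then D k' else 0) + mu1 - lambda k <= mu1 * D k.
    case: k => [|k].
      have := ler_wpM2l (ltW mu1_gt0) (D_ge 0%N); rewrite slopeE //; lra.
    rewrite {1}/D; case: (leP (slope lambda mu1 mu2 0 k) (- B)) => _.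
      have := ler_wpM2l (ltW mu1_gt0) (D_geB k.+1).
      by have := lambda_ge0 k.+1; lra.
    have := ler_wpM2l (ltW mu1_gt0) (D_ge k.+1); rewrite slopeE //=; lra.
  by case: k Dk => [|k] /= Dk; rewrite ?gS; lra.
- by rewrite tandem_generator //= subr0 addr0.
move=> [m k] y; rewrite /tandem_succ !mem_cat !inE => /or3P[].
- by move=> /eqP -> /=; rewrite -natr1; lra.
- case: ifP => // m0; rewrite inE => /eqP -> /=.
  have : m.-1%:R <= m%:R :> R by rewrite ler_nat leq_pred.
  by have := gS k; have := D_le0 k; lra.
- case: ifP => // k0; rewrite inE => /eqP -> /=.
  by case: k k0 => // k _ /=; have := gS k; have := D_geB k; lra.
Qed.

End TandemStability.

Theorem proposition1 (R : realType) (lambda : nat -> R) (mu1 mu2 : R)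
  (lambda_ge0 : forall n : nat, 0 <= lambda n)
  (mu1_gt0 : 0 < mu1) (mu2_gt0 : 0 < mu2)
  (lambda_nonincreasing : forall m n : nat, (m <= n)%N -> lambda n <= lambda m)
  (lambda_eventually0 :
     exists N : nat, forall n : nat, (N <= n)%N -> lambda n = 0)
  (mu1' : R) (le_mu1 : mu1 <= mu1')
  (d : measure_display) (Omega : measurableType d)
  (P : nat * nat -> probability Omega R)
  (X : R -> Omega -> option (nat * nat))
  (X_process : minimal_process (tandem_rate lambda mu1 mu2) P X)
  (d' : measure_display) (Omega' : measurableType d')
  (P' : nat * nat -> probability Omega' R)
  (X' : R -> Omega' -> option (nat * nat))
  (X'_process : minimal_process (tandem_rate lambda mu1' mu2) P' X') :
  ergodic P X -> ergodic P' X'.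
Proof.
move=> [irr pr].
have l0 := irreducible_lambda0 lambda_ge0 mu1_gt0 mu2_gt0 X_process irr.
have pos := positive_recurrent_slope_gt0 lambda_ge0 mu1_gt0 mu2_gt0
  lambda_nonincreasing lambda_eventually0 X_process l0 pr.
apply: (slope_gt0_ergodic lambda_ge0 _ mu2_gt0 lambda_nonincreasing
  lambda_eventually0 X'_process l0); first exact: lt_le_trans le_mu1.
exact: (slope_gt0_mono mu1_gt0 mu2_gt0 le_mu1 lambda_ge0 pos).
Qed.
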